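(* For every vertex $i\in\mathbb{V}$ the preconditioner $\mathcal{P}^{\mathrm{exact}}_{\le i}$ is exact, i.e. $\mathcal{P}^{\mathrm{exact}}_{\le i}=\mathcal{B}_{\le i}$.
   Context: **Data.** Let $\mathbb{D}=(\mathbb{V},\mathbb{A})$ be a directed rooted tree (arborescence) with vertices $\mathbb{V}=\{1,\dots,N\}$ and arcs $\mathbb{A}=\{a_1,\dots,a_M\}$ directed away from the root $R$. Each vertex $i$ has a symmetric matrix $B_i\in\mathbb{R}^{n_i\times n_i}$; each arc $a_k=(i,j)$ has a symmetric $D_k\in\mathbb{R}^{\ell_k\times\ell_k}$ and matrices $C_k^+\in\mathbb{R}^{\ell_k\times n_i}$, $C_k^-\in\mathbb{R}^{\ell_k\times n_j}$. A vertex is a leaf if it has no outgoing arcs, and an inner vertex otherwise. For $i\neq R$ let $\kappa(i)$ be the index of the unique arc entering $i$. For an inner vertex $i$ write its outgoing arcs as $a_{k_1}=(i,j_1),\dots,a_{k_r}=(i,j_r)$. **Nested matrices.** For a leaf $i$: $\mathcal{B}_{\le i}=B_i$, and $\mathcal{C}_i^-=C^-_{\kappa(i)}$ if $i\ne R$. For an inner vertex $i$: $\mathcal{D}_{\le i}=\mathrm{blkdiag}(D_{k_1},\dots,D_{k_r})$, $\mathcal{C}^+_{\le i}$ is the vertical stacking of $C^+_{k_1},\dots,C^+_{k_r}$, $\mathcal{C}^-_{\le i}=\mathrm{blkdiag}(\mathcal{C}^-_{j_1},\dots,\mathcal{C}^-_{j_r})$, and $$\mathcal{B}_{\le i}=\begin{pmatrix}\mathrm{blkdiag}(\mathcal{B}_{\le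 j_1},\dots,\mathcal{B}_{\le j_r}) & 0 & -(\mathcal{C}^-_{\le i})^T\\ 0 & B_i & (\mathcal{C}^+_{\le i})^T\\ -\mathcal{C}^-_{\le i} & \mathcal{C}^+_{\le i} & -\mathcal{D}_{\le i}\end{pmatrix};$$ for $i\neq R$, $\mathcal{C}_i^-=(0\ \cdots\ 0\ C^-_{\kappa(i)}\ 0)$, where $C^-_{\kappa(i)}$ occupies the columns of $\mathcal{B}_{\le i}$ containing the diagonal block $B_i$. For inner $i$, $$\mathcal{S}_{\le i}=\begin{pmatrix}-\mathcal{C}^-_{\le i}&\mathcal{C}^+_{\le i}\end{pmatrix}\mathrm{blkdiag}(\mathcal{B}_{\le j_1}^{-1},\dots,\mathcal{B}_{\le j_r}^{-1},B_i^{-1})\begin{pmatrix}-\mathcal{C}^-_{\le i}&\mathcal{C}^+_{\le i}\end{pmatrix}^T+\mathcal{D}_{\le i}.$$ **Standing assumptions.** All $B_i$ and all $\mathcal{B}_{\le i}$ are invertible, and all $\mathcal{S}_{\le i}$ ($i$ inner) are positive definite. Moreover, with $\mathcal{B}=\mathrm{blkdiag}(B_1,\dots,B_N)$, $\mathcal{D}=\mathrm{blkdiag}(D_1,\dots,D_M)$ and $\mathcal{C}$ the block matrix whose block row for $a_k=(i,j)$ has $C_k^+$ in block column $i$, $-C_k^-$ in block column $j$ and zeros elsewhere, the matrix $\mathcal{C}\mathcal{B}^{-1}\mathcal{C}^T+\mathcal{D}$ is positive definite. **Exact preconditioner.** Defined recursively from the leaves towards the root. For a leaf $i$, $\mathcal{P}^{\mathrm{exact}}_{\le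 i}=B_i$. For an inner vertex $i$, set $$\mathcal{P}^{\mathrm{rec}}_{\le i}=\begin{pmatrix}\mathrm{blkdiag}(\mathcal{P}^{\mathrm{exact}}_{\le j_1},\dots,\mathcal{P}^{\mathrm{exact}}_{\le j_r}) & 0 & 0\\ 0 & B_i & 0\\ -\mathcal{C}^-_{\le i} & \mathcal{C}^+_{\le i} & -\mathcal{S}_{\le i}\end{pmatrix}$$ and define $\mathcal{P}^{\mathrm{exact}}_{\le i}$ through its inverse $$(\mathcal{P}^{\mathrm{exact}}_{\le i})^{-1}=\bigl(2I-(\mathcal{P}^{\mathrm{rec}}_{\le i})^{-1}\mathcal{B}_{\le i}\bigr)(\mathcal{P}^{\mathrm{rec}}_{\le i})^{-1}.$$ *)

(* Defs.v *)
From mathcomp Require Import all_boot all_order all_algebra.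
From mathcomp Require Import reals.
Set Implicit Arguments.
Unset Strict Implicit.
Unset Printing Implicit Defensive.
Import Order.TTheory GRing.Theory Num.Theory.
Local Open Scope ring_scope.

Fixpoint is_walk (N M : nat) (src tgt : 'I_M -> 'I_N)
    (u : 'I_N) (p : seq 'I_M) (v : 'I_N) : bool :=
  if p is k :: p' then (src k == u) && is_walk src tgt (tgt k) p' v
  else u == v.

(* The arc [k] goes from [src k] to [tgt k].  A rooted directed graph is an
   arborescence when every vertex is reached from the root by exactly one
   directed walk; for the root itself this is the empty walk. *)
Record arborescence := Arborescence {
  nvert : nat;
  narc : nat;
  src : 'I_narc -> 'I_nvert;
  tgt : 'I_narc -> 'I_nvert;
  root : 'I_nvert;
  arboP : forall v, exists! p, is_walk src tgt root p v
}.

Section Graph.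
Variable T : arborescence.
Implicit Types (i j : 'I_(nvert T)) (k : 'I_(narc T)).

Definition out_arcs i : {set 'I_(narc T)} := [set k | src k == i].

Definition leaf i : bool := out_arcs i == set0.

(* The arcs leaving [i] are numbered [oarc i s], for s < #|out_arcs i|, in the
   order of their indices; this is the order of the blocks below. *)
Definition oarc i (s : 'I_#|out_arcs i|) : 'I_(narc T) := enum_val s.

Definition child j i : Prop := exists2 k, src k = i & tgt k = j.

Lemma child_oarc i (s : 'I_#|out_arcs i|) : child (tgt (oarc s)) i.
Proof. by exists (oarc s) => //; have := enum_valP s; rewrite inE => /eqP. Qed.

Lemma is_walk_rcons (u : 'I_(nvert T)) p k :
  is_walk (@src T) (@tgt T) u p (src k) ->
  is_walk (@src T) (@tgt T) u (rcons p k) (tgt k).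
Proof.
elim: p u => [|h p IHp] u /=; first by move=> /eqP ->; rewrite !eqxx.
by case/andP=> -> /IHp.
Qed.

Lemma child_acc i : Acc child i.
Proof.
have [f fP] := fin_all_exists (@arboP T).
have lef v p : is_walk (@src T) (@tgt T) (root T) p v ->
    (size p <= \max_w size (f w))%N.
  by move=> pP; rewrite -((fP v).2 p pP) (leq_bigmax v).
suff acc m v p : is_walk (@src T) (@tgt T) (root T) p v ->
    (\max_w size (f w) < m + size p)%N -> Acc child v.
  exact: acc (\max_w size (f w)).+1 i _ (fP i).1 (leq_addr _ _).
elim: m v p => [|m IHm] v p pP; first by rewrite add0n ltnNge (lef v).
move=> lt_m; constructor=> _ [k kv <-]; rewrite -kv in pP.
apply: (IHm _ (rcons p k)); first exact: is_walk_rcons.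
by rewrite size_rcons addnS.
Qed.

End Graph.

Section Blocks.
Variable R : realType.

(* [\mxdiag] only handles square blocks. *)
Definition rect_blkdiag (r : nat) (p q : 'I_r -> nat)
    (A : forall s, 'M[R]_(p s, q s)) : 'M[R]_(\sum_s p s, \sum_s q s) :=
  \mxblock_(s < r, t < r) (if s == t then conform_mx 0 (A s) else 0).

Definition posdefmx (n : nat) (A : 'M[R]_n) : Prop :=
  A \is symmetricmx /\
  forall x : 'cV[R]_n, x != 0 -> 0 < (x^T *m A *m x) 0 0.

End Blocks.

Record tree_data (R : realType) (T : arborescence) := TreeData {
  vdim : 'I_(nvert T) -> nat;
  adim : 'I_(narc T) -> nat;
  vB : forall i, 'M[R]_(vdim i);
  aD : forall k, 'M[R]_(adim k);
  aCp : forall k, 'M[R]_(adim k, vdim (src k));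
  aCm : forall k, 'M[R]_(adim k, vdim (tgt k));
  vB_sym : forall i, vB i \is symmetricmx;
  aD_sym : forall k, aD k \is symmetricmx
}.

Section Nested.
Variables (R : realType) (T : arborescence) (X : tree_data R T).
Local Notation V := 'I_(nvert T).
Local Notation A := 'I_(narc T).
Implicit Types (i : V) (k : A).

Definition glob_B : 'M[R]_(\sum_i vdim X i) := \mxdiag_i vB X i.
Definition glob_D : 'M[R]_(\sum_k adim X k) := \mxdiag_k aD X k.

(* When [src k = i] (resp. [tgt k = i]) the dimensions agree only up to this
   equation, so that [conform_mx] is a mere cast of C_k^+ (resp. C_k^-). *)
Definition Cp_at k i : 'M[R]_(adim X k, vdim X i) :=
  if src k == i then conform_mx 0 (aCp X k) else 0.
Definition Cm_at k i : 'M[R]_(adim X k, vdim X i) :=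
  if tgt k == i then conform_mx 0 (aCm X k) else 0.

Definition glob_C : 'M[R]_(\sum_k adim X k, \sum_i vdim X i) :=
  \mxblock_(k < narc T, i < nvert T) (Cp_at k i - Cm_at k i).

Section Inner.
Variable i : V.
Local Notation r := #|out_arcs i|.
Variable d : 'I_r -> nat.

Definition inner_dim : nat :=
  (\sum_s d s + vdim X i + \sum_(s < r) adim X (oarc s))%N.

Definition inner_D : 'M[R]_(\sum_(s < r) adim X (oarc s)) :=
  \mxdiag_(s < r) aD X (oarc s).

Definition inner_Cp : 'M[R]_(\sum_(s < r) adim X (oarc s), vdim X i) :=
  \mxcol_(s < r) Cp_at (oarc s) i.

(* Given, for each child j_s, a matrix of size [d s] and C_{j_s}^-. *)
Variable Cs : forall s, 'M[R]_(adim X (oarc s), d s).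

Definition inner_Cm : 'M[R]_(\sum_(s < r) adim X (oarc s), \sum_s d s) :=
  rect_blkdiag Cs.

Definition inner_B (Bs : forall s, 'M[R]_(d s)) : 'M[R]_inner_dim :=
  block_mx (block_mx (\mxdiag_s Bs s) 0 0 (vB X i))
           (col_mx (- inner_Cm^T) inner_Cp^T)
           (row_mx (- inner_Cm) inner_Cp)
           (- inner_D).

Definition inner_S (Bs : forall s, 'M[R]_(d s)) :
    'M[R]_(\sum_(s < r) adim X (oarc s)) :=
  row_mx (- inner_Cm) inner_Cp
    *m block_mx (\mxdiag_s invmx (Bs s)) 0 0 (invmx (vB X i))
    *m (row_mx (- inner_Cm) inner_Cp)^T
  + inner_D.

Definition inner_Prec (Ps Bs : forall s, 'M[R]_(d s)) : 'M[R]_inner_dim :=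
  block_mx (block_mx (\mxdiag_s Ps s) 0 0 (vB X i))
           0
           (row_mx (- inner_Cm) inner_Cp)
           (- inner_S Bs).

Definition inner_Pexact (Ps Bs : forall s, 'M[R]_(d s)) : 'M[R]_inner_dim :=
  invmx ((2%:M - invmx (inner_Prec Ps Bs) *m inner_B Bs)
           *m invmx (inner_Prec Ps Bs)).

End Inner.

(* The nested objects are defined by structural recursion on the accessibility
   of a vertex for the relation [child], i.e. from the leaves to the root. *)
Fixpoint nest_dim i (a : Acc (@child T) i) : nat :=
  match a with
  | Acc_intro f =>
      if leaf i then vdim X i
      else inner_dim (fun s => nest_dim (f _ (child_oarc s)))
  end.

(* For M = C_k^- with [k] the arc entering [i], this is the matrix C_i^-. *)
Definition nest_C i (a : Acc (@child T) i) (m : nat) (M : 'M[R]_(m, vdim X i)) :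
    'M[R]_(m, nest_dim a) :=
  match a with
  | Acc_intro f =>
      if leaf i as b return
        'M_(m, if b then vdim X i
               else inner_dim (fun s => nest_dim (f _ (child_oarc s))))
      then M else row_mx (row_mx 0 M) 0
  end.

Fixpoint nest_B i (a : Acc (@child T) i) : 'M[R]_(nest_dim a) :=
  match a with
  | Acc_intro f =>
      if leaf i as b return
        'M_(if b then vdim X i
            else inner_dim (fun s => nest_dim (f _ (child_oarc s))))
      then vB X i
      else inner_B (fun s => nest_C (f _ (child_oarc s)) (aCm X (oarc s)))
                   (fun s => nest_B (f _ (child_oarc s)))
  end.

Definition nest_S i (a : Acc (@child T) i) :
    'M[R]_(\sum_(s < #|out_arcs i|) adim X (oarc s)) :=
  match a with
  | Acc_intro f =>
      inner_S (fun s => nest_C (f _ (child_oarc s)) (aCm X (oarc s)))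
              (fun s => nest_B (f _ (child_oarc s)))
  end.

Fixpoint nest_Pexact i (a : Acc (@child T) i) : 'M[R]_(nest_dim a) :=
  match a with
  | Acc_intro f =>
      if leaf i as b return
        'M_(if b then vdim X i
            else inner_dim (fun s => nest_dim (f _ (child_oarc s))))
      then vB X i
      else inner_Pexact
             (fun s => nest_C (f _ (child_oarc s)) (aCm X (oarc s)))
             (fun s => nest_Pexact (f _ (child_oarc s)))
             (fun s => nest_B (f _ (child_oarc s)))
  end.

Definition dim_le i : nat := nest_dim (child_acc i).
Definition B_le i : 'M[R]_(dim_le i) := nest_B (child_acc i).
(* Meaningful for inner [i] only; for a leaf it is the empty matrix. *)
Definition S_le i : 'M[R]_(\sum_(s < #|out_arcs i|) adim X (oarc s)) :=
  nest_S (child_acc i).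
Definition Pexact_le i : 'M[R]_(dim_le i) := nest_Pexact (child_acc i).

End Nested.

(* Main.v *)
Require Import Defs.
From mathcomp Require Import all_boot all_order all_algebra.
From mathcomp Require Import boolp reals.
Import GRing.Theory Num.Theory.
Local Open Scope ring_scope.

(** Write the nested matrix of an inner vertex as [[A, E^T], [E, -D]], where A
    is block diagonal with the nested matrices of the children and the matrix
    of the vertex itself, and let S = E A^-1 E^T + D.  Once the preconditioners
    of the children are exact, the recursive preconditioner is
    P = [[A, 0], [E, -S]], and block elimination reads B = P U with
    U = [[1, A^-1 E^T], [0, 1]].  Since U - 1 squares to zero, the inverse of
    U = P^-1 B is 2 - U, so that (2 - P^-1 B) P^-1 = U^-1 P^-1 = B^-1: one
    correction step turns P into the exact inverse.  This is
    [block_correction_exact], and induction from the leaves to the root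
    propagates it through the tree.  The positive definiteness of S and the
    invertibility of the diagonal blocks make P invertible.

    The nested matrices depend on a proof of accessibility of the vertex; the
    recursion reaches a child with another proof than the one in the
    assumptions, and proof irrelevance identifies the two. *)

Lemma posdefmx_unit {R : realType} {n : nat} {A : 'M[R]_n} : posdefmx A -> A \in unitmx.
Proof.
case=> _ posA; rewrite unitmxE unitfE; apply/det0P => -[v v0 vA0].
have := posA v^T; rewrite trmx_eq0 trmxK vA0 mul0mx mxE Order.POrderTheory.ltxx.
by move=> /(_ v0).
Qed.

Lemma mxdiag_mulmxV {R : fieldType} {r : nat} {d : 'I_r -> nat}
    {B : forall s, 'M[R]_(d s)} :
  (forall s, B s \in unitmx) -> \mxdiag_s B s *m \mxdiag_s invmx (B s) = 1%:M.
Proof.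
move=> uB; rewrite -mxdiagZ mul_mxdiag_mxblock; apply/eq_mxblockP => i j.
have [e|_] := eqVneq i j; last by rewrite mulmx0.
by case: _ / e; rewrite !conform_mx_id mulmxV.
Qed.

(** Block elimination gives B = P U with U = 1 + N, where N has A' E^T as its
    only nonzero block.  As N^2 = 0, the correction factor 2 - U = 1 - N is the
    exact inverse of U and not merely its first Newton approximation. *)
Lemma block_correction_exact {R : fieldType} {m n : nat} {A A' : 'M[R]_m}
    {E : 'M[R]_(n, m)} {D : 'M[R]_n} :
  let S := E *m A' *m E^T + D in
  let P := block_mx A 0 E (- S) in
  let B := block_mx A E^T E (- D) in
  A *m A' = 1%:M -> S \in unitmx ->
  invmx ((2%:M - invmx P *m B) *m invmx P) = B.
Proof.
move=> S P B AA' uS.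
pose U := block_mx 1%:M (A' *m E^T) 0 1%:M.
have [uA _] := mulmx1_unit AA'.
have uP : P \in unitmx.
  rewrite unitmxE det_lblock unitrM -!unitmxE uA -scaleN1r unitmxZ //.
  by rewrite unitrN1.
have BPU : B = P *m U.
  rewrite /B /P /U mulmx_block !mulmx1 !mulmx0 !addr0 mulmxA AA' mul1mx.
  by rewrite /S mulmxA opprD addNKr.
have UV : (2%:M - U) *m U = 1%:M.
  have two_sub k : 2%:M - 1%:M = 1%:M :> 'M[R]_k by rewrite -raddfB addrK.
  rewrite scalar_mx_block opp_block_mx add_block_mx !two_sub mulmx_block.
  rewrite oppr0 addr0 add0r !mulmx1 !mulmx0 mul1mx mul0mx !addr0 subrr add0r.
  by rewrite -scalar_mx_block.
(* It remains to see that (2 - U) P^-1 is a left inverse of P U. *)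
rewrite BPU mulKmx //; set X := _ *m invmx P.
have XB : X *m (P *m U) = 1%:M by rewrite /X -mulmxA mulKmx.
have [uX _] := mulmx1_unit XB.
by rewrite -[RHS](mulKmx uX) XB mulmx1.
Qed.

Lemma inner_Pexact_exact {R : realType} {T : arborescence} {X : tree_data R T}
    {i : 'I_(nvert T)} {d : 'I_#|out_arcs i| -> nat}
    {Cs : forall s, 'M[R]_(adim X (oarc s), d s)}
    {Ps Bs : forall s, 'M[R]_(d s)} :
  vB X i \in unitmx -> (forall s, Bs s \in unitmx) ->
  inner_S Cs Bs \in unitmx -> (forall s, Ps s = Bs s) ->
  inner_Pexact Cs Ps Bs = inner_B Cs Bs.
Proof.
move=> uB uBs uS PB; rewrite /inner_Pexact /inner_Prec (eq_mxdiag PB).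
have -> : inner_B Cs Bs =
    block_mx (block_mx (\mxdiag_s Bs s) 0 0 (vB X i))
             (row_mx (- inner_Cm Cs) (inner_Cp X i))^T
             (row_mx (- inner_Cm Cs) (inner_Cp X i)) (- inner_D X i).
  by rewrite tr_row_mx linearN.
apply: block_correction_exact => //.
rewrite mulmx_block !mulmx0 !mul0mx !addr0 add0r mulmxV // mxdiag_mulmxV //.
by rewrite -scalar_mx_block.
Qed.

Theorem corollary3p4 (R : realType) (T : arborescence) (X : tree_data R T)
    (hB : forall i : 'I_(nvert T), vB X i \in unitmx)
    (hBle : forall i : 'I_(nvert T), B_le X i \in unitmx)
    (hS : forall i : 'I_(nvert T), ~~ leaf i -> posdefmx (S_le X i))
    (hglob : posdefmx (glob_C X *m invmx (glob_B X) *m (glob_C X)^T + glob_D X)) :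
  forall i : 'I_(nvert T), Pexact_le X i = B_le X i.
Proof.
have uB i (a : Acc (@child T) i) : nest_B X a \in unitmx.
  by rewrite (Prop_irrelevance a (child_acc i)); apply: hBle.
have uS i (a : Acc (@child T) i) : ~~ leaf i -> nest_S X a \in unitmx.
  rewrite (Prop_irrelevance a (child_acc i)) => /hS.
  exact: posdefmx_unit.
suff exact_nest i (a : Acc (@child T) i) : nest_Pexact X a = nest_B X a.
  by move=> i; apply: exact_nest.
elim: {i}(child_acc i) a => i _ IH [f].
have := uS i (Acc_intro i f) => /=.
case: (leaf i) => //= /(_ isT) uSi.
by apply: inner_Pexact_exact => // s; apply: IH; apply: child_oarc.
Qed.
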